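(* Let $(X,M_X)$ and $(Y,M_Y)$ be quasi-Borel spaces. Let $Y^X$ be the set of morphisms $X\to Y$, and let $$M_{Y^X}=\{\alpha\colon\mathbb{R}\to Y^X \mid \mathsf{uncurry}(\alpha)\colon \mathbb{R}\times X\to Y \text{ is a morphism of quasi-Borel spaces}\}.$$ Then $(Y^X,M_{Y^X})$ is a quasi-Borel space. The evaluation function $Y^X\times X\to Y$, $(f,x)\mapsto f(x)$, is a morphism and has the universal property of the function space (exponential). Thus the category $\mathbf{QBS}$ of quasi-Borel spaces and morphisms is cartesian closed.
   Context: A quasi-Borel space is a set $X$ together with a set $M_X$ of functions $\mathbb{R}\to X$ such that: (i) $\alpha\circ f\in M_X$ whenever $\alpha\in M_X$ and $f\colon\mathbb{R}\to\mathbb{R}$ is (Borel) measurable; (ii) every constant function $\mathbb{R}\to X$ is in $M_X$; (iii) if $\mathbb{R}=\biguplus_{i\in\mathbb{N}}S_i$ with each $S_i$ Borel and $\alpha_i\in M_X$ for each $i$, then $\beta\in M_X$, where $\beta(r)=\alpha_i(r)$ for $r\in S_i$. A morphism $(X,M_X)\to(Y,M_Y)$ is a function $f\colon X\to Y$ with $f\circ\alpha\in M_Y$ for all $\alpha\in M_X$; these form the category $\mathbf{QBS}$. $\mathbb{R}$ is regarded as a quasi-Borel space with $M_{\mathbb{R}}$ the set of measurable functions $\mathbb{R}\to\mathbb{R}$. The product of quasi-Borel spaces is the product set $\prod_i X_i$ with $M_{\prod_i X_i}=\{f\colon\mathbb{R}\to\prod_iX_i\mid \forall i.\ \pi_i\circ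 f\in M_{X_i}\}$. For $\alpha\colon\mathbb{R}\to Y^X$, $\mathsf{uncurry}(\alpha)(r,x)=\alpha(r)(x)$. *)

(* Defs.v *)
From mathcomp Require Import all_boot all_order all_algebra.
From mathcomp Require Import all_classical all_reals all_analysis.

Set Implicit Arguments.
Unset Strict Implicit.
Unset Printing Implicit Defensive.

Local Open Scope classical_set_scope.

(** * Categories *)

Record category := Category {
  object :> Type ;
  arrow : object -> object -> Type ;
  id_arrow : forall A, arrow A A ;
  comp_arrow : forall A B C, arrow B C -> arrow A B -> arrow A C ;
  comp_idl : forall A B (f : arrow A B), comp_arrow (id_arrow B) f = f ;
  comp_idr : forall A B (f : arrow A B), comp_arrow f (id_arrow A) = f ;
  comp_assoc : forall A B C D
      (h : arrow C D) (g : arrow B C) (f : arrow A B),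
    comp_arrow h (comp_arrow g f) = comp_arrow (comp_arrow h g) f
}.

Definition is_terminal (C : category) (T : C) : Prop :=
  forall A : C, exists! f : arrow A T, True.

Record binary_products (C : category) := BinaryProducts {
  prod_obj : C -> C -> C ;
  prod_fst : forall A B, arrow (prod_obj A B) A ;
  prod_snd : forall A B, arrow (prod_obj A B) B ;
  prod_pair : forall Z A B, arrow Z A -> arrow Z B -> arrow Z (prod_obj A B) ;
  prod_fst_pair : forall Z A B (f : arrow Z A) (g : arrow Z B),
    comp_arrow (prod_fst A B) (prod_pair f g) = f ;
  prod_snd_pair : forall Z A B (f : arrow Z A) (g : arrow Z B),
    comp_arrow (prod_snd A B) (prod_pair f g) = g ;
  prod_pair_uniq : forall Z A B (h : arrow Z (prod_obj A B)),
    prod_pair (comp_arrow (prod_fst A B) h) (comp_arrow (prod_snd A B) h) = h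
}.

(* [h * id_X : Z * X -> E * X] *)
Definition prod_map_id (C : category) (P : binary_products C) (Z E X : C)
    (h : arrow Z E) : arrow (prod_obj P Z X) (prod_obj P E X) :=
  prod_pair P (comp_arrow h (prod_fst P Z X)) (prod_snd P Z X).

Definition is_exponential (C : category) (P : binary_products C) (X Y E : C)
    (ev : arrow (prod_obj P E X) Y) : Prop :=
  forall (Z : C) (g : arrow (prod_obj P Z X) Y),
    exists! h : arrow Z E, comp_arrow ev (prod_map_id P X h) = g.

Definition cartesian_closed (C : category) : Prop :=
  (exists T : C, is_terminal T) /\
  (exists P : binary_products C,
     forall X Y : C, exists (E : C) (ev : arrow (prod_obj P E X) Y),
       is_exponential ev).

(** * Quasi-Borel spaces *)

(* The [sigma]-algebra carried by a [realType] in the library is the Borel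
   one, so [measurable] and [measurable_fun] below are Borel measurability. *)
Record is_qbs (R : realType) (X : Type) (M : set (R -> X)) : Prop := IsQbs {
  qbs_comp : forall (a : R -> X) (f : R -> R),
    M a -> measurable_fun setT f -> M (a \o f) ;
  qbs_const : forall x : X, M (fun=> x) ;
  qbs_glue : forall (S : nat -> set R) (a : nat -> R -> X) (b : R -> X),
    (forall i, measurable (S i)) ->
    trivIset setT S ->
    \bigcup_i S i = setT ->
    (forall i, M (a i)) ->
    (forall i r, S i r -> b r = a i r) ->
    M b
}.

Record qbs (R : realType) := Qbs {
  qbs_sort :> Type ;
  qbs_rand : set (R -> qbs_sort) ;
  qbs_axiom : is_qbs qbs_rand
}.

Arguments qbs_rand {R} _.

Definition is_qbs_mor (R : realType) (X Y : qbs R) (f : X -> Y) : Prop :=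
  forall a, qbs_rand X a -> qbs_rand Y (f \o a).

Record qbs_mor (R : realType) (X Y : qbs R) := QbsMor {
  qbs_fun :> X -> Y ;
  qbs_morP : is_qbs_mor qbs_fun
}.

Lemma qbs_mor_eq (R : realType) (X Y : qbs R) (f g : qbs_mor X Y) :
  f =1 g -> f = g.
Proof.
case: f g => [f pf] [g pg] /= /funext fg; case: g / fg in pg *.
by congr QbsMor; exact: Prop_irrelevance.
Qed.

Definition qbs_id (R : realType) (X : qbs R) : qbs_mor X X :=
  @QbsMor R X X id (fun a Ma => Ma).

Definition qbs_mor_comp (R : realType) (X Y Z : qbs R)
    (g : qbs_mor Y Z) (f : qbs_mor X Y) : qbs_mor X Z :=
  @QbsMor R X Z (g \o f) (fun a Ma => qbs_morP g (qbs_morP f Ma)).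

Definition QBS (R : realType) : category.
Proof.
apply: (@Category (qbs R) (@qbs_mor R) (@qbs_id R) (@qbs_mor_comp R)).
- by move=> A B f; exact: qbs_mor_eq.
- by move=> A B f; exact: qbs_mor_eq.
- by move=> A B C D h g f; exact: qbs_mor_eq.
Defined.

Lemma real_is_qbs (R : realType) :
  is_qbs [set f : R -> R | measurable_fun setT f].
Proof.
split => [a f /= ma mf|x|S a b mS _ covS ma ab] /=.
- exact: measurableT_comp.
- exact: measurable_cst.
- move=> _ B mB; rewrite setTI.
  have -> : b @^-1` B = \bigcup_i (S i `&` a i @^-1` B).
    apply/seteqP; split=> r /=.
      move=> Bbr; have : (\bigcup_i S i) r by rewrite covS.
      by case=> i _ Sir; exists i => //; split=> //=; rewrite -(ab _ _ Sir).
    by case=> i _ [Sir] /=; rewrite -(ab _ _ Sir).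
  apply: bigcupT_measurable => i; apply: measurableI => //.
  by rewrite -[_ @^-1` _]setTI; exact: ma.
Qed.

Definition real_qbs (R : realType) : qbs R := Qbs (real_is_qbs R).

Lemma prod_is_qbs (R : realType) (X Y : qbs R) :
  is_qbs [set a : R -> X * Y | qbs_rand X (fst \o a) /\ qbs_rand Y (snd \o a)].
Proof.
have [cX kX gX] := qbs_axiom X; have [cY kY gY] := qbs_axiom Y.
split => [a f [aX aY] mf|[x y]|S a b mS dS covS ma ab] /=.
- by split; [exact: (cX (fst \o a))|exact: (cY (snd \o a))].
- by split; [exact: kX|exact: kY].
- split.
  + apply: (gX S (fun i => fst \o a i)) => // [i|i r Sir].
      by have [] := ma i.
    by rewrite /= (ab _ _ Sir).
  + apply: (gY S (fun i => snd \o a i)) => // [i|i r Sir].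
      by have [] := ma i.
    by rewrite /= (ab _ _ Sir).
Qed.

Definition prod_qbs (R : realType) (X Y : qbs R) : qbs R :=
  Qbs (prod_is_qbs X Y).

Definition qbs_fst (R : realType) (X Y : qbs R) : qbs_mor (prod_qbs X Y) X :=
  @QbsMor R (prod_qbs X Y) X fst (fun a Ma => proj1 Ma).

Definition qbs_snd (R : realType) (X Y : qbs R) : qbs_mor (prod_qbs X Y) Y :=
  @QbsMor R (prod_qbs X Y) Y snd (fun a Ma => proj2 Ma).

Definition qbs_pair (R : realType) (Z X Y : qbs R)
    (f : qbs_mor Z X) (g : qbs_mor Z Y) : qbs_mor Z (prod_qbs X Y) :=
  @QbsMor R Z (prod_qbs X Y) (fun z => (f z, g z))
    (fun a Ma => conj (qbs_morP f Ma) (qbs_morP g Ma)).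

Definition QBS_products (R : realType) : binary_products (QBS R).
Proof.
apply: (@BinaryProducts (QBS R) (@prod_qbs R) (@qbs_fst R) (@qbs_snd R)
          (@qbs_pair R)).
- by move=> Z A B f g; exact: qbs_mor_eq.
- by move=> Z A B f g; exact: qbs_mor_eq.
- by move=> Z A B h; apply: qbs_mor_eq => z /=; case: (h z).
Defined.

Definition uncurry_mor (R : realType) (X Y : qbs R) (a : R -> qbs_mor X Y) :
    prod_qbs (real_qbs R) X -> Y :=
  fun p => a p.1 p.2.

Definition exp_rand (R : realType) (X Y : qbs R) : set (R -> qbs_mor X Y) :=
  [set a | is_qbs_mor (uncurry_mor a)].

(* Main.v *)
(* A random element of [R * X] is a pair [(c1, c2)] with [c1] measurable.
   Gluing in [Y^X] along [S i] therefore becomes gluing in [Y] along the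
   Borel sets [c1 @^-1` S i].  Evaluation composes [uncurry a] with the random
   elements [r |-> (r, c2 r)], and transposition reduces to closure of [M_Z]
   under precomposition with [c1]. *)
Require Import Defs.
From mathcomp Require Import all_boot all_order all_algebra.
From mathcomp Require Import all_classical all_reals all_analysis.

Set Implicit Arguments.
Unset Strict Implicit.
Unset Printing Implicit Defensive.

Local Open Scope classical_set_scope.

Lemma exp_is_qbs (R : realType) (X Y : qbs R) : is_qbs (@exp_rand R X Y).
Proof.
split => [a f Ma mf c [/= mc1 Mc2]|f c [/= _ Mc2]|S a b mS dS covS Ma ab c].
(* Reindexing by [f] is absorbed into the test element: [uncurry_mor (a \o f) \o c] is
   [uncurry_mor a] after [(f \o c1, c2)], again random in the product. *)
- apply: (Ma (fun r => (f (c r).1, (c r).2))).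
  by split => //=; exact: (measurableT_comp mf mc1).
- exact: (qbs_morP f Mc2).
- move=> [/= mc1 Mc2].
  apply: (qbs_glue (qbs_axiom Y) (S := fun i => (fst \o c) @^-1` S i)
            (a := fun i => uncurry_mor (a i) \o c)).
  + by move=> i; rewrite -[_ @^-1` _]setTI; exact: mc1.
  + by move=> i j _ _ [r [Sir Sjr]]; apply: dS => //; exists (c r).1.
  + by rewrite -preimage_bigcup covS preimage_setT.
  + by move=> i; exact: Ma.
  + by move=> i r Sir; rewrite /= /uncurry_mor (ab i).
Qed.

Definition exp_qbs (R : realType) (X Y : qbs R) : qbs R :=
  Qbs (@exp_is_qbs R X Y).

Lemma eval_is_qbs_mor (R : realType) (X Y : qbs R) :
  @is_qbs_mor R (prod_qbs (exp_qbs X Y) X) Y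
    (fun p : qbs_mor X Y * X => p.1 p.2).
Proof.
move=> a [/= Ma1 Ma2]; apply: (Ma1 (fun r => (r, (a r).2))).
by split => //=; exact: measurable_id.
Qed.

(** Freezing the first coordinate pairs a random element of [X] with a constant one, and constants
    are random in [Z]. *)
Lemma section_is_qbs_mor (R : realType) (X Y Z : qbs R)
    (g : qbs_mor (prod_qbs Z X) Y) (z : Z) :
  is_qbs_mor (fun x : X => g (z, x)).
Proof.
move=> a Ma; apply: (qbs_morP g (a := fun r => (z, a r))).
by split => //=; exact: (qbs_const (qbs_axiom Z)).
Qed.

Definition qbs_section (R : realType) (X Y Z : qbs R)
    (g : qbs_mor (prod_qbs Z X) Y) (z : Z) : qbs_mor X Y :=
  QbsMor (section_is_qbs_mor g z).

Lemma curry_is_qbs_mor (R : realType) (X Y Z : qbs R)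
    (g : qbs_mor (prod_qbs Z X) Y) :
  @is_qbs_mor R Z (exp_qbs X Y) (qbs_section g).
Proof.
move=> a Ma c [/= mc1 Mc2].
apply: (qbs_morP g (a := fun r => (a (c r).1, (c r).2))).
by split => //=; exact: (qbs_comp (qbs_axiom Z) Ma mc1).
Qed.

Lemma eval_is_exponential (R : realType) (X Y : qbs R) :
  @is_exponential (QBS R) (QBS_products R) X Y (exp_qbs X Y)
    (QbsMor (@eval_is_qbs_mor R X Y)).
Proof.
move=> Z g; exists (QbsMor (curry_is_qbs_mor g)); split.
  by apply: qbs_mor_eq => -[z x].
(* Once [g] is replaced by its factorisation through [h], its section at [z] sends [x] to [h z x] by
   computation; uniqueness is extensionality in [z], then in [x]. *)
by move=> h <-; apply: qbs_mor_eq => z; exact: qbs_mor_eq.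
Qed.

Lemma unit_is_qbs (R : realType) : is_qbs [set: R -> unit].
Proof. by split. Qed.

Lemma unit_is_terminal (R : realType) :
  @is_terminal (QBS R) (Qbs (@unit_is_qbs R)).
Proof.
move=> A; have tt_mor : @is_qbs_mor R A (Qbs (@unit_is_qbs R)) (fun=> tt) by [].
exists (QbsMor tt_mor); split=> // f _.
by apply: qbs_mor_eq => x; case: (RHS).
Qed.

(** The existentials [expP] and [evP] range over proofs only, so the exponential is pinned to the
    prescribed [exp_rand] and its arrow to literal evaluation. *)
Theorem proposition18 (R : realType) :
  (forall X Y : qbs R,
     exists expP : is_qbs (@exp_rand R X Y),
       let E : qbs R := Qbs expP in
       exists evP : @is_qbs_mor R (prod_qbs E X) Y
                      (fun p : qbs_mor X Y * X => p.1 p.2),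
         @is_exponential (QBS R) (QBS_products R) X Y E (QbsMor evP)) /\
  cartesian_closed (QBS R).
Proof.
split=> [X Y|].
  by exists (@exp_is_qbs R X Y), (@eval_is_qbs_mor R X Y);
    exact: eval_is_exponential.
split; first by eexists; exact: unit_is_terminal.
by exists (QBS_products R) => X Y; do 2 eexists; exact: eval_is_exponential.
Qed.
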